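(* Let $G=\mathrm{SL}_n(\mathbb C)$ and let $$\tau(M)=M^T,\qquad \alpha(M)=JM^TJ,\qquad \iota(M)=M^{-1},$$ where $J$ is the anti-diagonal permutation matrix ($Je_i=e_{n+1-i}$). For all $u,v\in S_n$ these three maps induce biregular identifications $$\tau\bigl(\mathbb D(G^{u,v})\bigr)=\mathbb D(G^{v^{-1},u^{-1}}),\qquad \alpha\bigl(\mathbb D(G^{u,v})\bigr)=\mathbb D(G^{w_0u^{-1}w_0,\,w_0v^{-1}w_0}),\qquad \iota\bigl(\mathbb D(G^{u,v})\bigr)=\mathbb D(G^{u^{-1},v^{-1}}).$$ In particular, all three involutions preserve $\mathbb D(G^{w_0,w_0})$. They also preserve the irreducible components (they carry the irreducible components of $\mathbb D(G^{u,v})$ bijectively to those of its image), all finite intersections of components, and the dimensions of these intersections.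
   Context: $G=\mathrm{SL}_n(\mathbb C)$, $n\ge2$; $B$ (resp. $B^-$) is the subgroup of upper (resp. lower) triangular matrices, $H=B\cap B^-$ the diagonal matrices, $W=S_n$ with simple reflections $s_i=(i,i+1)$, Coxeter length $\ell$ and longest element $w_0$. For $u,v\in S_n$, $G^{u,v}=B\dot uB\cap B^-\dot vB^-$, where $\dot w\in N_G(H)$ represents $w$. Put $x_i(t)=I+tE_{i,i+1}$ and $x_{\bar i}(t)=I+tE_{i+1,i}$ for $1\le i\le n-1$. $R(u,v)$ is the set of words $\mathbf i=(i_1,\dots,i_m)$, $m=\ell(u)+\ell(v)$, in the alphabet $\{\bar1,\dots,\overline{n-1},1,\dots,n-1\}$ whose barred subword is a reduced word of $u$ (bars removed) and whose unbarred subword is a reduced word of $v$. Put $T_{\mathbf i}=\{h\,x_{i_1}(t_1)\cdots x_{i_m}(t_m): h\in H,\ t_k\in\mathbb C^*\}\subset G^{u,v}$. The reduced-word deep locus is $\mathbb D(G^{u,v})=G^{u,v}\setminus\bigcup_{\mathbf i\in R(u,v)}T_{\mathbf i}$. *)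

(* Defs.v *)
From HB Require Import structures.
From mathcomp Require Import all_boot all_order all_algebra all_fingroup.
From mathcomp Require Import complex.
From mathcomp Require Import boolp classical_sets functions cardinality.
From mathcomp Require Import reals constructive_ereal ereal.
From mathcomp.multinomials Require mpoly.

Set Implicit Arguments.
Unset Strict Implicit.
Unset Printing Implicit Defensive.

Import Order.TTheory GRing.Theory Num.Theory.

Local Open Scope ring_scope.
Local Open Scope classical_set_scope.

(* Indices are 0-based: [i : 'I_n.-1] stands for the simple reflection        *)
(* exchanging the points [i] and [i + 1] of ['I_n].                           *)

Section Coxeter.
Variable n : nat.
Implicit Types (i : 'I_n.-1) (s : seq 'I_n.-1) (w : 'S_n).

Fact ord_lo_proof i : (i < n)%N.
Proof. exact: leq_trans (ltn_ord i) (leq_pred n). Qed.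

Fact ord_hi_proof i : (i.+1 < n)%N.
Proof. by rewrite -ltn_predRL. Qed.

Definition ord_lo i : 'I_n := Ordinal (ord_lo_proof i).
Definition ord_hi i : 'I_n := Ordinal (ord_hi_proof i).

Definition simple_refl i : 'S_n := tperm (ord_lo i) (ord_hi i).

(* The product of permutations is composition from right to left, as for      *)
(* column permutation matrices, whereas [(s * t)%g] applies [s] first; hence  *)
(* the reversal: [word_perm [:: i1; ..; ik]] is s_{i1} \o .. \o s_{ik}.       *)
Definition word_perm s : 'S_n := (\prod_(i <- rev s) simple_refl i)%g.

Lemma word_perm_cat s1 s2 :
  word_perm (s1 ++ s2) = (word_perm s2 * word_perm s1)%g.
Proof. by rewrite /word_perm rev_cat big_cat. Qed.

Lemma word_perm_tperm (i j : 'I_n) :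
  (i < j)%N -> exists s, word_perm s = tperm i j.
Proof.
case: j => j; elim: j => // j IHj ltjn /=; rewrite ltnS leq_eqVlt.
have ltj : (j < n.-1)%N by rewrite ltn_predRL.
have hiE : ord_hi (Ordinal ltj) = Ordinal ltjn by apply: val_inj.
case/orP=> [/eqP eq_ij | lt_ij].
  exists [:: Ordinal ltj]; rewrite /word_perm big_seq1 /simple_refl hiE.
  by congr tperm; apply: val_inj.
have [s sE] := IHj (ltnW ltjn) lt_ij.
exists ([:: Ordinal ltj] ++ s ++ [:: Ordinal ltj]).
rewrite !word_perm_cat sE /word_perm big_seq1 -mulgA.
set r := simple_refl _; have rV : (r^-1 = r)%g by apply: tpermV.
rewrite -{1}rV -/(conjg _ _) tpermJ; congr tperm.
  by rewrite tpermD // -val_eqE /= gtn_eqF // ltnS ltnW.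
by rewrite -hiE /r /simple_refl -[RHS](tpermL (ord_lo (Ordinal ltj)));
   congr (tperm _ _ _); apply: val_inj.
Qed.

Lemma word_perm_surj w : exists s, word_perm s = w.
Proof.
have [ts -> _] := prod_tpermP w.
elim: ts => [|[i j] ts [s sE]]; first by exists [::]; rewrite /word_perm !big_nil.
have [t tE] : exists t, word_perm t = tperm i j.
  have [/word_perm_tperm //|/word_perm_tperm|/val_inj ->] := ltngtP i j.
    by rewrite tpermC.
  by exists [::]; rewrite /word_perm big_nil tperm1.
by exists (s ++ t); rewrite word_perm_cat tE sE big_cons.
Qed.

Fact coxlen_subproof w :
  exists k, [exists s : k.-tuple 'I_n.-1, word_perm s == w].
Proof.
have [s sE] := word_perm_surj w.
by exists (size s); apply/existsP; exists (in_tuple s); rewrite sE.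
Qed.

Definition coxlen w : nat := ex_minn (coxlen_subproof w).

Definition reduced_word w s : Prop := word_perm s = w /\ size s = coxlen w.

Definition longest : 'S_n := [arg max_(w > 1%g) coxlen w]%N.

(* The letter [(true, i)] is the barred letter of index [i], and [(false, i)] *)
(* the unbarred one.                                                          *)
Definition letter : Type := bool * 'I_n.-1.

Definition barred_subword (x : seq letter) : seq 'I_n.-1 :=
  [seq l.2 | l <- x & l.1].

Definition unbarred_subword (x : seq letter) : seq 'I_n.-1 :=
  [seq l.2 | l <- x & ~~ l.1].

Definition double_word (u v : 'S_n) : set (seq letter) :=
  [set x | [/\ size x = (coxlen u + coxlen v)%N,
               reduced_word u (barred_subword x) &
               reduced_word v (unbarred_subword x)]].

End Coxeter.

Section DeepLocus.
Variables (R : realType) (n : nat).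
Local Notation C := R[i].
Local Notation mat := 'M[C]_n.
Implicit Types (M : mat) (u v w : 'S_n).

Definition SL : set mat := [set M | \det M = 1].

(* [is_trig_mx] means lower triangular. *)
Definition borel : set mat := SL `&` [set M | is_trig_mx M^T].
Definition borel_opp : set mat := SL `&` [set M | is_trig_mx M].
Definition torus : set mat := borel `&` borel_opp.

(* The elements of N_G(H) above w are the matrices of SL_n that send each     *)
(* basis vector e_j to a nonzero multiple of e_(w j).                         *)
Definition represents M w : Prop :=
  SL M /\ forall i j, (M i j != 0) = (i == w j).

Definition double_coset (P : set mat) w : set mat :=
  [set M | exists b1 N b2,
    [/\ P b1, represents N w, P b2 & M = b1 *m N *m b2]].

Definition bruhat_cell u v : set mat :=
  double_coset borel u `&` double_coset borel_opp v.

Definition elem_mx (l : letter n) (t : C) : mat :=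
  1%:M + t *: (if l.1 then delta_mx (ord_hi l.2) (ord_lo l.2)
               else delta_mx (ord_lo l.2) (ord_hi l.2)).

Definition word_torus (x : seq (letter n)) : set mat :=
  [set M | exists h (t : 'I_(size x) -> C),
    [/\ torus h, forall k, t k != 0 &
        M = h *m \prod_(k < size x) elem_mx (tnth (in_tuple x) k) (t k)]].

Definition deep_locus u v : set mat :=
  bruhat_cell u v `\` \bigcup_(x in double_word u v) word_torus x.

Definition anti_mx : mat := \matrix_(i, j) (i == rev_ord j)%:R.

Definition tau_map M : mat := M^T.
Definition alpha_map M : mat := anti_mx *m M^T *m anti_mx.
Definition iota_map M : mat := invmx M.

End DeepLocus.

(* Subsets of the affine space of n x n matrices, with the topology and the   *)
(* regular functions induced by the Zariski structure of that affine space.   *)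
Section Zariski.
Variables (R : realType) (n : nat).
Local Notation C := R[i].
Local Notation mat := 'M[C]_n.
Implicit Types (X Y Z : set mat) (M : mat).

Definition mx_poly : Type := mpoly.mpoly (n * n) C.

Definition mx_eval (p : mx_poly) M : C := mpoly.meval (mxvec M 0) p.

Definition zclosed Z : Prop :=
  exists S : set mx_poly, Z = [set M | forall p, S p -> mx_eval p M = 0].

Definition closed_in X Z : Prop := exists2 A, zclosed A & Z = X `&` A.

Definition irreducible Z : Prop :=
  Z !=set0 /\
  forall A B, zclosed A -> zclosed B -> Z `<=` A `|` B -> Z `<=` A \/ Z `<=` B.

Definition irr_components X : set (set mat) :=
  [set Z | [/\ irreducible Z, Z `<=` X &
    forall Z', irreducible Z' -> Z' `<=` X -> Z `<=` Z' -> Z' = Z]].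

(* Krull dimension; the empty set has dimension [-oo].                        *)
Definition zdim X : \bar R :=
  ereal_sup [set (k%:R)%:E | k in [set k : nat |
    exists Z : 'I_k.+1 -> set mat,
      (forall i, irreducible (Z i) /\ closed_in X (Z i)) /\
      (forall i j : 'I_k.+1, (i < j)%N -> Z i `<` Z j)]].

Definition regular_fun X (f : mat -> C) : Prop :=
  forall M, X M -> exists p q : mx_poly, mx_eval q M != 0 /\
    forall M', X M' -> mx_eval q M' != 0 -> f M' = mx_eval p M' / mx_eval q M'.

Definition regular_map X Y (f : mat -> mat) : Prop :=
  set_fun X Y f /\ forall i j, regular_fun X (fun M => f M i j).

Definition biregular X Y (f : mat -> mat) : Prop :=
  regular_map X Y f /\
  exists g : mat -> mat, [/\ regular_map Y X g,
    forall M, X M -> g (f M) = M & forall M, Y M -> f (g M) = M].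

Definition preserves_components X (f : mat -> mat) : Prop :=
  set_bij (irr_components X) (irr_components (f @` X)) (fun Z => f @` Z) /\
  forall F : set (set mat),
    finite_set F -> F !=set0 -> F `<=` irr_components X ->
    f @` (\bigcap_(Z in F) Z) = \bigcap_(Z in F) (f @` Z) /\
    zdim (f @` (\bigcap_(Z in F) Z)) = zdim (\bigcap_(Z in F) Z).

End Zariski.

(* Main.v *)
Require Import Defs.
From mathcomp Require Import all_boot all_order all_algebra all_fingroup.
From mathcomp Require Import complex boolp classical_sets functions reals ereal.
From mathcomp.multinomials Require Import -(notations) mpoly.
From mathcomp Require Import zify.

(** Each of the three maps f is an involution of SL_n that reverses products,
    preserves or exchanges the two Borel subgroups, sends the matrices above w
    to those above g w for an anti-automorphism g of S_n, and sends each
    one-parameter subgroup x_i or x_{bar i} to one of these.  Such an f, called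
    an [antisymmetry] below, carries a double coset B w B to a double coset of
    g w, and a product h x_{i_1}(t_1) .. x_{i_m}(t_m) to the reversed product
    followed by f h; the torus factor f h can be pushed back to the left, which
    only rescales the parameters by nonzero factors.  As g reverses reduced
    words, f maps the double cells and the toric charts of the source into those
    of the target, and since f is an involution it also pulls the target charts
    back: deep points go to deep points, in both directions
    ([anti_deep_locus_image]).

    The map alpha acts on permutations by conjugating the inverse by the
    reversal j |-> n - 1 - j, so its part of the statement needs the element of
    maximal Coxeter length to be this reversal.  That is [longestE]; it rests on
    the equality of Coxeter length and number of inversions ([coxlenE]).

    The geometric assertions follow formally from f being an involution of SL_n
    given there by polynomials in the entries (for the inverse, the
    cofactors): such a map pulls Zariski closed sets back to closed sets and is
    its own inverse, so it transports irreducible sets, components and chains of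
    irreducible closed subsets. *)

Set Implicit Arguments.
Unset Strict Implicit.
Unset Printing Implicit Defensive.
Import GRing.Theory.

(** * Coxeter length and inversions *)

Section Inversions.
Variable n : nat.
Implicit Types (w : 'S_n) (i : 'I_n.-1).

Definition inversions w : {set 'I_n * 'I_n} :=
  [set p : 'I_n * 'I_n | (p.1 < p.2)%N && (w p.2 < w p.1)%N].

Lemma simple_reflK i : (simple_refl i * simple_refl i = 1)%g.
Proof. exact: tperm2. Qed.

Lemma simple_refl_lt i (a b : 'I_n) :
  (a < b)%N -> (a, b) != (ord_lo i, ord_hi i) ->
  (simple_refl i a < simple_refl i b)%N.
Proof.
move=> ab nd; have {nd} : ~ (a = i :> nat /\ b = i.+1 :> nat).
  by case=> ai bi; move: nd; rewrite xpair_eqE -!val_eqE /= ai bi !eqxx.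
move: ab; rewrite /simple_refl.
by case: (tpermP _ _ a) => [->|->|/eqP + /eqP];
   case: (tpermP _ _ b) => [->|->|/eqP + /eqP]; rewrite -?val_eqE /=; lia.
Qed.

(** Precomposing with s_i permutes the pairs of positions by s_i; apart from the
    pair (i, i+1) this keeps pairs ordered and transports inversions, and
    (i, i+1) itself becomes an inversion. *)
Lemma inversions_simple_refl w i :
  (w (ord_lo i) < w (ord_hi i))%N ->
  #|inversions (simple_refl i * w)%g| = #|inversions w|.+1.
Proof.
move=> asc; set s := simple_refl i; set d := (ord_lo i, ord_hi i).
have sK : involutive s by move=> x; rewrite /s /simple_refl tpermK.
pose f (p : 'I_n * 'I_n) := (s p.1, s p.2).
have fK : involutive f by case=> a b; rewrite /f /= !sK.
have d_inv : d \in inversions (s * w)%g.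
  by rewrite inE /= !permM /s /simple_refl tpermL tpermR ltnSn asc.
rewrite (cardsD1 d) d_inv add1n -[in RHS](card_imset _ (inv_inj fK)); congr _.+1.
apply: eq_card => -[a b]; rewrite in_setD1.
have -> : ((a, b) \in f @: inversions w)
          = ((s a, s b) \in inversions w).
  by rewrite -(mem_imset _ (s a, s b) (inv_inj fK)) /f /= !sK.
rewrite !inE /= !permM {d_inv}/d.
have [[-> ->]|nd] := eqVneq (a, b) (ord_lo i, ord_hi i).
  by rewrite /s /simple_refl !tpermL !tpermR /=; lia.
have [ab|ba|/val_inj ->] := ltngtP a b; last by rewrite !ltnn.
  by rewrite simple_refl_lt.
have [[-> ->]|nd'] := eqVneq (b, a) (ord_lo i, ord_hi i).
  by rewrite /s /simple_refl !tpermL !tpermR /=; lia.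
by have := simple_refl_lt ba nd'; rewrite -/s; lia.
Qed.

Lemma inversions_simple_refl_desc w i :
  (w (ord_hi i) < w (ord_lo i))%N ->
  #|inversions w| = #|inversions (simple_refl i * w)%g|.+1.
Proof.
move=> desc; rewrite -{1}[w]mul1g -(simple_reflK i) -mulgA.
by apply: inversions_simple_refl; rewrite !permM /simple_refl tpermL tpermR.
Qed.

Lemma inversions1 : #|inversions 1%g| = 0%N.
Proof. by apply: eq_card0 => -[a b]; rewrite !inE /= !perm1; lia. Qed.

(** Being increasing forces j <= w j everywhere, and both sides have the same
    sum over all j. *)
Lemma no_descent_eq1 w :
  (forall i, (w (ord_lo i) < w (ord_hi i))%N) -> w = 1%g.
Proof.
move=> asc; have ge (j : 'I_n) : (j <= w j)%N.
  case: j => j; elim: j => [|j IHj] ltjn //.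
  have ltj : (j < n.-1)%N by lia.
  have lo_j : ord_lo (Ordinal ltj) = Ordinal (ltnW ltjn) by apply: val_inj.
  have hi_j : ord_hi (Ordinal ltj) = Ordinal ltjn by apply: val_inj.
  have := asc (Ordinal ltj); rewrite lo_j hi_j.
  exact/leq_ltn_trans/IHj.
have /leqif_sum [_] : forall j : 'I_n, true -> (j <= w j ?= iff (j == w j :> nat))%N.
  by move=> j _; apply/leqifP; case: eqP => // /eqP; rewrite ltn_neqAle ge => ->.
rewrite [X in _ == X](reindex_inj (@perm_inj _ w^-1%g)) /=.
under [X in _ == X]eq_bigr do rewrite permKV.
rewrite eqxx => /esym/forallP fix_w; apply/permP=> j.
by rewrite perm1; apply/esym/val_inj/eqP; have := fix_w j.
Qed.

Lemma word_perm_rcons s i :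
  word_perm (rcons s i) = (simple_refl i * word_perm s)%g.
Proof. by rewrite -cats1 word_perm_cat {1}/word_perm big_seq1. Qed.

Lemma card_inversions_word s : (#|inversions (word_perm s)| <= size s)%N.
Proof.
elim/last_ind: s => [|s i IHs]; first by rewrite /word_perm big_nil inversions1.
rewrite word_perm_rcons size_rcons; set w := word_perm s in IHs *.
have [asc|desc|/val_inj/perm_inj/(congr1 val)/=] :=
  ltngtP (w (ord_lo i)) (w (ord_hi i)); last by lia.
  by rewrite inversions_simple_refl.
by move: IHs; rewrite (inversions_simple_refl_desc desc); lia.
Qed.

(** A word is found by undoing descents one at a time. *)
Lemma word_of_inversions w : exists2 s, word_perm s = w & size s = #|inversions w|.
Proof.
have [m] := ubnP #|inversions w|; elim: m w => // m IHm w lt_w.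
have [[i desc]|no_desc] :=
    pselect (exists i, (w (ord_hi i) < w (ord_lo i))%N); last first.
  suff -> : w = 1%g by exists [::]; rewrite ?inversions1 // /word_perm big_nil.
  apply: no_descent_eq1 => i.
  case: ltngtP => [//|desc|/val_inj/perm_inj/(congr1 val)/=]; last by lia.
  by case: no_desc; exists i.
have inv_w := inversions_simple_refl_desc desc.
have [|s sE sz_s] := IHm (simple_refl i * w)%g; first by rewrite -ltnS -inv_w.
exists (rcons s i); last by rewrite size_rcons sz_s.
by rewrite word_perm_rcons sE mulgA simple_reflK mul1g.
Qed.

Lemma coxlenP w :
  (exists2 s, word_perm s = w & size s = coxlen w) /\
  forall s, word_perm s = w -> (coxlen w <= size s)%N.
Proof.
rewrite /coxlen; case: ex_minnP => k /existsP[t /eqP tE] min_k; split.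
  by exists t; rewrite ?size_tuple.
by move=> s sE; apply: min_k; apply/existsP; exists (in_tuple s); rewrite sE.
Qed.

Lemma coxlenE w : coxlen w = #|inversions w|.
Proof.
have [[s sE sz_s] min_w] := coxlenP w; have [t tE sz_t] := word_of_inversions w.
apply/eqP; rewrite eqn_leq -{1}sz_t min_w //= -sz_s -{1}sE.
exact: card_inversions_word.
Qed.

Definition rev_perm : 'S_n := perm (@rev_ord_inj n).

Lemma rev_permE j : rev_perm j = rev_ord j.
Proof. exact: permE. Qed.

Lemma rev_permK : (rev_perm * rev_perm = 1)%g.
Proof. by apply/permP=> j; rewrite permM perm1 !rev_permE rev_ordK. Qed.

(** A longest element has no ascent, since composing with s_i there would lengthen
    it; hence its composite with the reversal has no descent and is trivial. *)
Lemma longestE : longest n = rev_perm.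
Proof.
rewrite /longest; case: arg_maxnP => // w _ max_w.
suff w_rev : (w * rev_perm = 1)%g.
  by rewrite -[w]mulg1 -rev_permK mulgA w_rev mul1g.
apply: no_descent_eq1 => i; rewrite !permM !rev_permE /=.
have [asc|desc|/val_inj/perm_inj/(congr1 val)/=] :=
  ltngtP (w (ord_lo i)) (w (ord_hi i)); [|have := ltn_ord (w (ord_lo i)); lia|lia].
have := max_w (simple_refl i * w)%g isT.
by rewrite /= !coxlenE inversions_simple_refl // ltnn.
Qed.

End Inversions.

(** * Anti-automorphisms of the symmetric group *)

Section WordReversal.
Variable n : nat.
Implicit Types (w : 'S_n) (s : seq 'I_n.-1).

(** The anti-automorphisms of S_n that permute the simple reflections, described
    by their effect on words so that reduced words can be followed directly. *)
Definition reverses_words (sigma : 'I_n.-1 -> 'I_n.-1) (g : 'S_n -> 'S_n) : Prop :=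
  forall s, g (word_perm s) = word_perm (rev (map sigma s)).

Lemma reverses_words_inv : reverses_words id (fun w => w^-1)%g.
Proof.
move=> s; rewrite map_id /word_perm revK -prodgV.
by apply: eq_bigr => i _; apply: tpermV.
Qed.

Lemma ord_lo_rev (i : 'I_n.-1) : ord_lo (rev_ord i) = rev_ord (ord_hi i).
Proof. by apply: val_inj => /=; lia. Qed.

Lemma ord_hi_rev (i : 'I_n.-1) : ord_hi (rev_ord i) = rev_ord (ord_lo i).
Proof. by apply: val_inj => /=; have := ltn_ord i; lia. Qed.

Lemma reverses_words_rev_perm :
  reverses_words (@rev_ord _) (fun w => rev_perm n * w^-1 * rev_perm n)%g.
Proof.
move=> s; rewrite (reverses_words_inv s) map_id -map_rev.
have rV : (rev_perm n)^-1%g = rev_perm n by apply/mulg1_eq/rev_permK.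
elim: (rev s) => [|i t IHt].
  by rewrite /word_perm !big_nil mulg1 rev_permK.
rewrite -cat1s map_cat !word_perm_cat -IHt.
have -> : word_perm [:: rev_ord i] = (rev_perm n * word_perm [:: i] * rev_perm n)%g.
  rewrite /word_perm !big_seq1 -{1}rV -mulgA -conjgE tpermJ !rev_permE.
  by rewrite /simple_refl ord_lo_rev ord_hi_rev tpermC.
by rewrite !mulgA -[(_ * rev_perm n * rev_perm n)%g]mulgA rev_permK mulg1.
Qed.

Variables (sigma : 'I_n.-1 -> 'I_n.-1) (g : 'S_n -> 'S_n).
Hypotheses (gK : involutive g) (gw : reverses_words sigma g).

(** Words are carried to words of the same length; the reverse inequality is the
    same bound applied to the involution. *)
Lemma coxlen_reverse w : coxlen (g w) = coxlen w.
Proof.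
have le_len w' : (coxlen (g w') <= coxlen w')%N.
  have [[t tE <-] _] := coxlenP w'; have [_ min_g] := coxlenP (g w').
  by rewrite -(size_map sigma t) -size_rev min_g // -gw tE.
by apply/eqP; rewrite eqn_leq le_len /= -{1}[w]gK le_len.
Qed.

Lemma reduced_word_reverse w s :
  reduced_word w s -> reduced_word (g w) (rev (map sigma s)).
Proof.
by case=> sE sz_s; split; rewrite -?gw ?sE // size_rev size_map coxlen_reverse.
Qed.

End WordReversal.

(** * Products of elementary matrices *)

Section Words.
Variables (R : realType) (n : nat).
Local Notation C := (complex R).
Local Notation mat := 'M[C]_n.
Implicit Types (x : seq (letter n)) (A B M h : mat) (w : 'S_n).
Local Open Scope ring_scope.
Local Open Scope classical_set_scope.

(** The chart of a word without its torus factor, in a recursive form suited to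
    induction on the word. *)
Fixpoint word_cell x : set mat :=
  if x is l :: x' then
    [set M | exists t A, [/\ t != 0, word_cell x' A & M = elem_mx l t *m A]]
  else [set 1%:M].

Lemma word_cellP x M :
  word_cell x M <-> exists t : 'I_(size x) -> C, (forall k, t k != 0) /\
    M = \prod_(k < size x) elem_mx (tnth (in_tuple x) k) (t k).
Proof.
elim: x M => [|l x IHx] M /=.
  split=> [->|[t [_ ->]]]; last by rewrite big_ord0.
  by exists (fun=> 0); split=> [[]|] //; rewrite big_ord0.
split=> [[t0 [A [t0_nz /IHx[t [t_nz ->]] ->]]]|[t [t_nz ->]]].
  exists (fun k => oapp t t0 (unlift ord0 k)); split=> [k|].
    by case: unliftP => [j _|_] /=; rewrite ?t_nz.
  rewrite big_ord_recl unlift_none mulmxE; congr (elem_mx _ _ * _).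
  by apply: eq_bigr => k _; rewrite liftK !(tnth_nth l).
exists (t ord0), (\prod_(k < size x) elem_mx (tnth (in_tuple x) k) (t (lift ord0 k))).
split=> //; first by apply/IHx; exists (fun k => t (lift ord0 k)).
rewrite big_ord_recl mulmxE; congr (elem_mx _ _ * _).
by apply: eq_bigr => k _; rewrite !(tnth_nth l).
Qed.

Lemma word_torusE x :
  word_torus x = [set M | exists h A, [/\ torus h, word_cell x A & M = h *m A]].
Proof.
apply/seteqP; split=> M /=.
  case=> h [t [h_tor t_nz ->]]; exists h.
  exists (\prod_(k < size x) elem_mx (tnth (in_tuple x) k) (t k)).
  by split=> //; apply/word_cellP; exists t.
by case=> h [A [h_tor /word_cellP[t [t_nz ->]] ->]]; exists h, t.
Qed.

Lemma word_cell_rcons x l A t :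
  word_cell x A -> t != 0 -> word_cell (rcons x l) (A *m elem_mx l t).
Proof.
move=> + t_nz; elim: x A => [|l' x IHx] A /=.
  by move=> ->; exists t, 1%:M; rewrite mul1mx mulmx1.
case=> t' [A' [t'_nz A'x ->]]; exists t', (A' *m elem_mx l t).
by split=> //; [apply: IHx | rewrite mulmxA].
Qed.

Lemma det_elem_mx (l : letter n) t : \det (elem_mx l t : mat) = 1.
Proof.
case: l => b i; rewrite /elem_mx /=.
have trig : is_trig_mx (1%:M + t *: delta_mx (ord_hi i) (ord_lo i) : mat).
  apply/is_trig_mxP => j k lt_jk; rewrite !mxE -!val_eqE /= (ltn_eqF lt_jk) add0r.
  by case: eqP => [ji|]; case: eqP => [ki|]; rewrite ?mulr0 //; lia.
have det1 : \det (1%:M + t *: delta_mx (ord_hi i) (ord_lo i) : mat) = 1.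
  rewrite (det_trig trig) big1 // => j _; rewrite !mxE eqxx -!val_eqE /=.
  by case: eqP => [ji|]; case: eqP => [ki|]; rewrite ?mulr0 ?addr0 //; lia.
case: b => //; rewrite -det_tr -[RHS]det1; congr (\det _).
by rewrite linearD linearZ /= trmx1 trmx_delta.
Qed.

Lemma word_cell_SL x A : word_cell x A -> SL A.
Proof.
elim: x A => [|l x IHx] A /=; first by move=> ->; rewrite /SL /= det1.
by case=> t [A' [_ /IHx + ->]]; rewrite /SL /= det_mulmx det_elem_mx mul1r.
Qed.

Lemma torus_diag h :
  torus h -> exists2 d : 'rV_n, h = diag_mx d & forall i, d 0 i != 0.
Proof.
case=> -[h1 htr] [_ hr]; have /is_diag_mxP diag_h : is_diag_mx h.
  by rewrite is_diag_mxEtrig; apply/andP; split.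
exists (\row_i h i i).
  apply/matrixP=> i j; rewrite !mxE; have [->|/eqP ij] := eqVneq; first by [].
  by rewrite mulr0n diag_h //; apply/eqP => /val_inj.
move=> i; rewrite mxE; apply/eqP => hi0; move: h1.
rewrite /SL /= det_trig // (bigD1 i) //= hi0 mul0r => /esym/eqP.
by rewrite oner_eq0.
Qed.

(** The torus normalizes each one-parameter subgroup, acting on its parameter by
    a root. *)
Lemma elem_mx_diag (l : letter n) t (d : 'rV[C]_n) :
  (forall i, d 0 i != 0) -> t != 0 ->
  exists2 t', t' != 0 & elem_mx l t *m diag_mx d = diag_mx d *m elem_mx l t'.
Proof.
move=> d_nz t_nz; case: l => b i.
set p := if b then (ord_hi i, ord_lo i) else (ord_lo i, ord_hi i).
have elE s : elem_mx (b, i) s = 1%:M + s *: delta_mx p.1 p.2 :> mat.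
  by rewrite /p /elem_mx; case: b {p}.
exists (t * d 0 p.2 / d 0 p.1).
  by rewrite !mulf_neq0 ?invr_eq0.
apply/matrixP=> j k; rewrite !elE mul_mx_diag mul_diag_mx !mxE.
rewrite mulrDl mulrDr; congr (_ + _).
  by case: eqVneq => [->|_]; rewrite ?mulr1 ?mul1r ?mulr0 ?mul0r.
case: eqVneq => [->|_]; last by rewrite /= !mulr0 mul0r.
case: eqVneq => [->|_]; last by rewrite /= !mulr0 mul0r.
by rewrite /= !mulr1 mulrCA divff ?mulr1.
Qed.

(** What brings the torus factor, which a product-reversing map leaves on the
    right, back to its place on the left. *)
Lemma word_cell_torus x A h :
  torus h -> word_cell x A -> exists2 A', word_cell x A' & A *m h = h *m A'.
Proof.
move=> /torus_diag[d -> d_nz]; elim: x A => [|l x IHx] A /=.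
  by move=> ->; exists 1%:M; rewrite ?mul1mx ?mulmx1.
case=> t [A1 [t_nz /IHx[A2 A2x A12] ->]].
have [t' t'_nz tE] := elem_mx_diag l d_nz t_nz.
exists (elem_mx l t' *m A2); first by exists t', A2.
by rewrite -mulmxA A12 !mulmxA tE.
Qed.

End Words.

(** * Antisymmetries and the deep locus *)

Section Antisymmetry.
Variables (R : realType) (n : nat).
Local Notation C := (complex R).
Local Notation mat := 'M[C]_n.
Local Open Scope ring_scope.
Local Open Scope classical_set_scope.
Implicit Types (A B M N h : mat) (u v w : 'S_n) (x : seq (letter n)) (b : bool).

Definition borel_of b : set mat := if b then @borel_opp R n else @borel R n.

(** What transpose, inverse and reflection in the antidiagonal have in common.
    The bit [swap] says whether upper and lower triangular matrices are
    exchanged, [sigma] is the action on indices of simple reflections, and [g]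
    the induced map on the Weyl group. *)
Record antisymmetry (swap : bool) (sigma : 'I_n.-1 -> 'I_n.-1)
    (g : 'S_n -> 'S_n) (f : mat -> mat) : Prop := Antisymmetry {
  anti_permK : involutive g;
  anti_word : reverses_words sigma g;
  anti_SL : forall M, SL M -> SL (f M);
  antiK : forall M, SL M -> f (f M) = M;
  antiM : forall A B, SL A -> SL B -> f (A *m B) = f B *m f A;
  anti_borel : forall b M, borel_of b M -> borel_of (b (+) swap) (f M);
  anti_represents : forall N w, represents N w -> represents (f N) (g w);
  anti_elem : forall l t, t != 0 ->
    exists2 t', t' != 0 & f (elem_mx l t) = elem_mx (l.1 (+) swap, sigma l.2) t'
}.

Variables (swap : bool) (sigma : 'I_n.-1 -> 'I_n.-1).
Variables (g : 'S_n -> 'S_n) (f : mat -> mat).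
Hypothesis fA : antisymmetry swap sigma g f.

(** When B and its opposite are exchanged, the two permutations indexing a double
    cell trade places. *)
Definition anti_cell (D : 'S_n -> 'S_n -> set mat) u v : set mat :=
  if swap then D (g v) (g u) else D (g u) (g v).

Definition anti_letters x : seq (letter n) :=
  rev [seq (l.1 (+) swap, sigma l.2) | l <- x].

Lemma SL1 : SL (1%:M : mat). Proof. exact: det1. Qed.

Lemma SLM A B : SL A -> SL B -> SL (A *m B).
Proof. by rewrite /SL /= det_mulmx => -> ->; rewrite mulr1. Qed.

Lemma borel_of_SL b M : borel_of b M -> SL M.
Proof. by case: b => -[]. Qed.

Lemma deep_locus_SL u v M : deep_locus u v M -> SL M.
Proof.
case=> -[[b1 [N [b2 [[? _] [? _] [? _] ->]]]] _] _.
by do 2?apply: SLM.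
Qed.

(** Reversing products makes f 1 neutral for values of f, and 1 is such a value. *)
Lemma anti1 : f 1%:M = 1%:M.
Proof.
have f1_SL := anti_SL fA SL1.
have := antiM fA f1_SL SL1.
by rewrite mulmx1 !(antiK fA) ?mulmx1; [move=> <-|exact: SL1].
Qed.

Lemma anti_double_coset b w M :
  double_coset (borel_of b) w M -> double_coset (borel_of (b (+) swap)) (g w) (f M).
Proof.
case=> b1 [N [b2 [Bb1 Nw Bb2 ->]]].
have [b1S NS b2S] := And3 (borel_of_SL Bb1) Nw.1 (borel_of_SL Bb2).
exists (f b2), (f N), (f b1); split;
  [exact: (anti_borel fA)|exact: (anti_represents fA)|exact: (anti_borel fA)|].
by rewrite !(antiM fA) ?mulmxA //; exact: SLM.
Qed.

Lemma anti_bruhat_cell u v M :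
  bruhat_cell u v M -> anti_cell (@bruhat_cell R n) u v (f M).
Proof.
move=> [/(@anti_double_coset false) uM /(@anti_double_coset true) vM].
by move: uM vM; rewrite /anti_cell; case: swap => ? ?; split.
Qed.

Lemma anti_torus h : torus h -> torus (f h).
Proof.
case=> /(@anti_borel _ _ _ _ fA false) + /(@anti_borel _ _ _ _ fA true).
by case: swap => ? ?; split.
Qed.

Lemma anti_word_cell x A : word_cell x A -> word_cell (anti_letters x) (f A).
Proof.
elim: x A => [|l x IHx] A /=; first by move=> ->; exact: anti1.
case=> t [A' [t_nz xA' ->]]; have [t' t'_nz tE] := anti_elem fA l t_nz.
rewrite (antiM fA) ?tE; [|exact: det_elem_mx|exact: word_cell_SL xA'].
by rewrite /anti_letters /= rev_cons; apply: word_cell_rcons => //; exact: IHx.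
Qed.

Lemma anti_word_torus x M : word_torus x M -> word_torus (anti_letters x) (f M).
Proof.
rewrite !word_torusE => -[h [A [h_tor xA ->]]].
rewrite (antiM fA); [|exact: h_tor.1.1|exact: word_cell_SL xA].
have [A' A'x ->] := word_cell_torus (anti_torus h_tor) (anti_word_cell xA).
by exists (f h), A'; split=> //; exact: anti_torus.
Qed.

Lemma anti_double_word u v x :
  double_word u v x ->
  if swap then double_word (g v) (g u) (anti_letters x)
  else double_word (g u) (g v) (anti_letters x).
Proof.
have subE b : [seq l.2 | l <- anti_letters x & l.1 == b]
    = rev (map sigma [seq l.2 | l <- x & l.1 == b (+) swap]).
  rewrite /anti_letters filter_rev map_rev filter_map -!map_comp; congr rev.
  congr map; apply: eq_filter => l /=; by case: l.1 b swap => [] [] [].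
have barE y : barred_subword y = [seq l.2 | l <- y & l.1 == true].
  by congr map; apply: eq_filter => l; rewrite eqb_id.
have unbarE y : unbarred_subword y = [seq l.2 | l <- y & l.1 == false].
  by congr map; apply: eq_filter => l; rewrite eqbF_neg.
have reduced := reduced_word_reverse (anti_permK fA) (anti_word fA).
have len := coxlen_reverse (anti_permK fA) (anti_word fA).
case=> sz_x; rewrite barE unbarE => /reduced ru /reduced rv.
have sz : size (anti_letters x) = (coxlen (g u) + coxlen (g v))%N.
  by rewrite size_rev size_map sz_x !len.
by move: subE; case: swap sz => sz subE; split; rewrite ?barE ?unbarE ?subE // addnC.
Qed.

(** If f M were in the chart of a word y, then M = f (f M) would be in the chart of
    the word obtained from y, which is a double word of (u, v). *)
Lemma anti_deep_locus u v M :
  deep_locus u v M -> anti_cell (@deep_locus R n) u v (f M).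
Proof.
move=> uvM'; have MS := deep_locus_SL uvM'; case: uvM' => uvM deepM.
have fM_cell := anti_bruhat_cell uvM.
have gK := anti_permK fA.
have not_word y : word_torus y (f M) -> ~ double_word u v (anti_letters y).
  move=> /anti_word_torus; rewrite (antiK fA) // => yM uvy.
  by apply: deepM; exists (anti_letters y).
move: fM_cell not_word (@anti_double_word); rewrite /anti_cell.
case: swap => fM_cell not_word dw; split=> // -[y y_word yM];
  by apply: (not_word y); rewrite //; have := dw _ _ _ y_word; rewrite !gK.
Qed.

Lemma anti_deep_locus_image u v :
  f @` deep_locus u v = anti_cell (@deep_locus R n) u v.
Proof.
apply/seteqP; split=> [_ [M uvM <-]|M gM]; first exact: anti_deep_locus.
have MS : SL M by move: gM; rewrite /anti_cell; case: swap; apply: deep_locus_SL.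
exists (f M); last by rewrite (antiK fA).
move: gM (@anti_deep_locus); rewrite /anti_cell.
by case: swap => gM deep; have := deep _ _ _ gM; rewrite !(anti_permK fA).
Qed.

End Antisymmetry.

(** * The three maps *)

Section ThreeMaps.
Variables (R : realType) (n : nat).
Local Notation C := (complex R).
Local Notation mat := 'M[C]_n.
Local Open Scope ring_scope.
Local Open Scope classical_set_scope.
Implicit Types (A B M N : mat) (w : 'S_n).

Lemma represents_tr N w : represents N w -> represents N^T (w^-1)%g.
Proof.
case=> NS Nw; split; first by rewrite /SL /= det_tr.
move=> i j; rewrite mxE Nw; apply/eqP/eqP => [->|->]; first by rewrite permK.
by rewrite permKV.
Qed.

Lemma tau_antisymmetry :
  antisymmetry true id (fun w => w^-1)%g (@tau_map R n).
Proof.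
split=> //.
- exact: invgK.
- exact: reverses_words_inv.
- by move=> M MS; rewrite /SL /= det_tr.
- by move=> M _; exact: trmxK.
- by move=> A B _ _; exact: trmx_mul.
- by case=> M [MS trigM]; split; rewrite /SL /= /tau_map ?det_tr ?trmxK.
- by move=> N w; exact: represents_tr.
- move=> [b i] t t_nz; exists t => //; rewrite /tau_map /elem_mx.
  by case: b; rewrite linearD linearZ /= trmx1 trmx_delta.
Qed.

Lemma invmx_eq A B : A *m B = 1%:M -> invmx A = B.
Proof.
move=> AB; have [uA _] := mulmx1_unit AB.
by rewrite -[LHS]mulmx1 -AB mulKmx.
Qed.

Lemma SL_unit M : SL M -> M \in unitmx.
Proof. by rewrite unitmxE => ->; rewrite unitr1. Qed.

Lemma SL_inv M : SL M -> SL (invmx M).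
Proof. by rewrite /SL /= det_inv => ->; rewrite invr1. Qed.

(** Forward substitution: row [i] of the inverse is determined by the rows above it. *)
Lemma invmx_trig M : M \in unitmx -> is_trig_mx M -> is_trig_mx (invmx M).
Proof.
move=> uM trigM; have diag_nz i : M i i != 0.
  apply/eqP => Mi0; move: uM; rewrite unitmxE det_trig // (bigD1 i) //= Mi0 mul0r.
  by rewrite unitr0.
apply/is_trig_mxP => -[ i lti].
have [m] := ubnP i; elim: m i lti => // m IHm i lti lt_im j ij.
have := congr1 (fun A : mat => A (Ordinal lti) j) (mulmxV uM).
rewrite mxE (bigD1 (Ordinal lti)) //= big1 ?addr0.
  rewrite mxE -val_eqE /= (ltn_eqF ij) => /eqP; rewrite mulf_eq0 (negPf (diag_nz _)).
  by move/eqP.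
move=> [k ltk] /= k_i; have [ki|ik|ki] := ltngtP k i.
- by rewrite (IHm k) ?mulr0 //; [exact: leq_trans ki _ | exact: ltn_trans ki _].
- by rewrite (is_trig_mxP trigM) ?mul0r.
- by rewrite -val_eqE /= ki eqxx in k_i.
Qed.

(** The inverse of a monomial matrix; the zero entries rely on [0^-1 = 0]. *)
Lemma invmx_represents N w : represents N w ->
  invmx N = \matrix_(i, j) (N j i)^-1.
Proof.
case=> _ Nw; have N0 i j : i != w j -> N i j = 0.
  by rewrite -Nw negbK => /eqP.
apply: invmx_eq; apply/matrixP=> i k; rewrite !mxE (bigD1 (w^-1%g i)) //= mxE.
rewrite big1 => [|j ji]; last first.
  by rewrite N0 ?mul0r //; apply: contraNneq ji => ->; rewrite permK.
rewrite addr0; have [<-|ik] := eqVneq i k; first by rewrite divff // Nw permKV.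
by rewrite (N0 k) ?invr0 ?mulr0 // permKV eq_sym.
Qed.

Lemma elem_mxN (l : letter n) (t : C) : elem_mx l t *m elem_mx l (- t) = 1%:M.
Proof.
have mul0 (i j : 'I_n) : i != j ->
    (1%:M + t *: delta_mx i j) *m (1%:M + (- t) *: delta_mx i j) = 1%:M :> mat.
  move=> ij; rewrite mulmxDl mul1mx mulmxDr mulmx1 -scalemxAl -scalemxAr.
  by rewrite mul_delta_mx_0 1?eq_sym // !scaler0 addr0 scaleNr addrNK.
by case: l => b i; rewrite /elem_mx; case: b; apply: mul0; rewrite -val_eqE /=; lia.
Qed.

Lemma iota_antisymmetry :
  antisymmetry false id (fun w => w^-1)%g (@iota_map R n).
Proof.
split=> //.
- exact: invgK.
- exact: reverses_words_inv.
- exact: SL_inv.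
- by move=> M _; exact: invmxK.
- move=> A B /SL_unit uA /SL_unit uB; apply: invmx_eq.
  by rewrite -!mulmxA (mulmxA B) mulmxV // mul1mx mulmxV.
- move=> b M; rewrite addbF.
  case: b => -[MS trigM]; split; rewrite /iota_map; try exact: SL_inv.
    by apply: invmx_trig => //; exact: SL_unit.
  rewrite /= trmx_inv; apply: invmx_trig => //.
  by rewrite unitmx_tr; exact: SL_unit.
- move=> N w Nw; split; first exact/SL_inv/Nw.1.
  move=> i j; rewrite /iota_map (invmx_represents Nw) mxE invr_eq0.
  by have [_ /(_ i j)] := represents_tr Nw; rewrite mxE.
- move=> [b i] t t_nz; exists (- t); first by rewrite oppr_eq0.
  by rewrite addbF; apply/invmx_eq/elem_mxN.
Qed.

Lemma alphaE M i j : alpha_map M i j = M (rev_ord j) (rev_ord i).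
Proof.
rewrite /alpha_map mxE (bigD1 (rev_ord j)) //= big1 ?addr0 => [|k kj]; last first.
  by rewrite [anti_mx _ _ _ _]mxE (negPf kj) mulr0.
rewrite [anti_mx _ _ _ _]mxE eqxx mulr1 mxE (bigD1 (rev_ord i)) //=.
rewrite big1 ?addr0 => [|k ki]; first by rewrite !mxE rev_ordK eqxx mul1r.
by rewrite mxE eq_sym (can2_eq rev_ordK rev_ordK) (negPf ki) mul0r.
Qed.

Lemma anti_mxK : anti_mx R n *m anti_mx R n = 1%:M.
Proof.
apply/matrixP=> i j; rewrite !mxE (bigD1 (rev_ord j)) //= big1 ?addr0 => [|k kj].
  by rewrite !mxE rev_ordK eqxx mulr1.
by rewrite !mxE (negPf kj) mulr0.
Qed.

Lemma alpha_SL M : SL M -> SL (alpha_map M).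
Proof.
rewrite /SL /= /alpha_map !det_mulmx det_tr => ->.
by rewrite mulr1 -det_mulmx anti_mxK det1.
Qed.

Lemma alpha_antisymmetry :
  antisymmetry false (@rev_ord _) (fun w => rev_perm n * w^-1 * rev_perm n)%g
    (@alpha_map R n).
Proof.
have rV : (rev_perm n)^-1%g = rev_perm n by apply/mulg1_eq/rev_permK.
split.
- move=> w; rewrite !invMg invgK rV !mulgA rev_permK mul1g.
  by rewrite -mulgA rev_permK mulg1.
- exact: reverses_words_rev_perm.
- exact: alpha_SL.
- by move=> M _; apply/matrixP=> i j; rewrite !alphaE !rev_ordK.
- move=> A B _ _; rewrite /alpha_map trmx_mul.
  by rewrite -[in LHS](mul1mx A^T) -anti_mxK !mulmxA.
- move=> b M; rewrite addbF.
  case: b => -[MS /is_trig_mxP trigM]; (split; first exact: alpha_SL);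
    apply/is_trig_mxP => i j ij; have := trigM (rev_ord j) (rev_ord i);
    by rewrite ?[_^T _ _]mxE alphaE => -> //=; have := ltn_ord j; lia.
- move=> N w [NS Nw]; split; first exact: alpha_SL.
  move=> i j; rewrite alphaE Nw !permM !rev_permE.
  by rewrite [RHS]eq_sym [RHS](can2_eq rev_ordK rev_ordK) (can2_eq (permKV w) (permK w)).
- move=> [b i] t t_nz; exists t => //; rewrite addbF /elem_mx.
  apply/matrixP => j k; rewrite alphaE.
  rewrite /= ord_lo_rev ord_hi_rev; case: b; rewrite !mxE.
  all: rewrite (inj_eq rev_ord_inj) !(can2_eq rev_ordK rev_ordK).
  all: by rewrite andbC (eq_sym k).
Qed.

End ThreeMaps.

(** * Polynomial involutions and Zariski geometry *)

Section Transport.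
Variables (R : realType) (n : nat).
Local Notation C := (complex R).
Local Notation mat := 'M[C]_n.
Local Open Scope ring_scope.
Local Open Scope classical_set_scope.
Implicit Types (X Y Z A S : set mat) (M : mat) (f : mat -> mat).

(** Only the values on S matter: matrix inversion is polynomial on SL_n, but not
    on all matrices. *)
Definition polynomial_on S f : Prop :=
  exists P : 'M[mpoly (n * n) C]_n,
    forall M, S M -> forall i j, f M i j = mx_eval (P i j) M.

Lemma mx_eval1 M : mx_eval (1 : mpoly (n * n) C) M = 1.
Proof. exact: meval1. Qed.

Lemma polynomial_on_regular S f X Y : polynomial_on S f -> X `<=` S ->
  set_fun X Y f -> regular_map X Y f.
Proof.
move=> [P fP] XS fXY; split=> // i j M XM; exists (P i j), 1.
rewrite mx_eval1; split=> [|M' XM' _]; first exact: oner_neq0.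
by rewrite mx_eval1 divr1; apply/fP/XS.
Qed.

(** Substituting the polynomials of f into the equations of A gives equations for
    the preimage. *)
Lemma zclosed_preimage S f A : polynomial_on S f -> zclosed A ->
  exists2 A', zclosed A' & forall M, S M -> A' M <-> A (f M).
Proof.
move=> [P fP] [E ->].
pose lq := [tuple (mxvec P 0 k : mpoly (n * n) C) | k < n * n].
exists [set M | forall q : mx_poly R n,
    [set comp_mpoly lq p | p in E] q -> mx_eval q M = 0].
  by exists [set comp_mpoly lq p | p in E].
move=> M SM; have evalE p : mx_eval (comp_mpoly lq p) M = mx_eval p (f M).
  rewrite /mx_eval comp_mpoly_meval; apply: meval_eq => k.
  by rewrite tnth_mktuple; case/mxvec_indexP: k => i j; rewrite !mxvecE fP.
split=> [AM p Ep|AM _ [p Ep <-]]; last by rewrite evalE AM.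
by rewrite /= -evalE; apply: AM; exists p.
Qed.

Variables (S : set mat) (f : mat -> mat).
Hypotheses (fP : polynomial_on S f) (fS : forall M, S M -> S (f M)).
Hypothesis fK : forall M, S M -> f (f M) = M.

Lemma image_subS X : X `<=` S -> f @` X `<=` S.
Proof. by move=> XS _ [M /XS /fS ? <-]. Qed.

Lemma imageK X : X `<=` S -> f @` (f @` X) = X.
Proof.
move=> XS; apply/seteqP; split=> [_ [_ [M XM <-] <-]|M XM].
  by rewrite fK //; exact: XS.
by exists (f M); [exists M | rewrite fK //; exact: XS].
Qed.

Lemma image_irreducible Z : Z `<=` S -> irreducible Z -> irreducible (f @` Z).
Proof.
move=> ZS [[M ZM] irrZ]; split; first by exists (f M), M.
move=> A B /(zclosed_preimage fP)[A' clA' A'E] /(zclosed_preimage fP)[B' clB' B'E] AB.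
have [M' ZM'|ZA|ZB] := irrZ A' B' clA' clB'.
- have [|AM|BM] := AB (f M'); first by exists M'.
    by left; apply/(A'E _ (ZS _ ZM')).
  by right; apply/(B'E _ (ZS _ ZM')).
- by left=> _ [M' ZM' <-]; apply/(A'E _ (ZS _ ZM'))/ZA.
- by right=> _ [M' ZM' <-]; apply/(B'E _ (ZS _ ZM'))/ZB.
Qed.

(** As f is its own inverse on S, an image is a preimage. *)
Lemma image_closed_in X Z : X `<=` S -> closed_in X Z -> closed_in (f @` X) (f @` Z).
Proof.
move=> XS [A /(zclosed_preimage fP)[A' clA' A'E] ->]; exists A' => //.
apply/seteqP; split=> [_ [M [XM AM] <-]|_ [[M XM <-] A'fM]].
  split; first by exists M.
  by apply/A'E; [exact/fS/XS | rewrite fK //; exact: XS].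
exists M => //; split=> //.
by rewrite -[M]fK; [apply/A'E => //; exact/fS/XS | exact: XS].
Qed.

Lemma image_irr_components X Z : X `<=` S ->
  irr_components X Z -> irr_components (f @` X) (f @` Z).
Proof.
move=> XS [irrZ ZX maxZ]; have ZS := subset_trans ZX XS.
split; [exact: image_irreducible|exact: image_subset|move=> Z' irrZ' Z'fX fZZ'].
have Z'S := subset_trans Z'fX (image_subS XS).
rewrite -[Z']imageK //; congr (f @` _); apply: maxZ.
- exact: image_irreducible.
- by rewrite -[X]imageK //; exact: image_subset.
- by rewrite -[Z]imageK //; exact: image_subset.
Qed.

(** Chains of irreducible closed subsets are carried to chains of the same length;
    applying f again gives the other inequality. *)
Lemma image_zdim X : X `<=` S -> zdim (f @` X) = zdim X.
Proof.
have chain Y k : Y `<=` S ->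
    (exists Z : 'I_k.+1 -> set mat, (forall i, irreducible (Z i) /\ closed_in Y (Z i)) /\
      (forall i j : 'I_k.+1, (i < j)%N -> Z i `<` Z j)) ->
    exists Z : 'I_k.+1 -> set mat,
      (forall i, irreducible (Z i) /\ closed_in (f @` Y) (Z i)) /\
      (forall i j : 'I_k.+1, (i < j)%N -> Z i `<` Z j).
  move=> YS [Z [irrZ ltZ]]; have ZS i : Z i `<=` S.
    by have [_ [A _ ->]] := irrZ i; move=> M [/YS].
  exists (fun i => f @` Z i); split=> [i|i j /ltZ].
    have [irrZi clZi] := irrZ i.
    by split; [exact: image_irreducible|exact: image_closed_in].
  rewrite !properEneq => -[neqZ subZ]; split; last exact: image_subset.
  by apply: contra_neq neqZ => fZ; rewrite -[Z i]imageK // fZ imageK.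
move=> XS; rewrite /zdim; congr ereal_sup; congr image.
apply/seteqP; split=> k; last exact: chain.
by move/(chain _ _ (image_subS XS)); rewrite imageK.
Qed.

(** Injectivity on S makes images commute with nonempty intersections; nonemptiness
    of the family keeps the intersection inside S. *)
Lemma involution_preserves_components X : X `<=` S -> preserves_components X f.
Proof.
move=> XS; have compS Y Z : Y `<=` S -> irr_components Y Z -> Z `<=` S.
  by move=> YS [_ ZY _]; exact: subset_trans ZY YS.
split.
  split=> [Z|Z Z'|Z fXZ]; first exact: image_irr_components.
    rewrite !inE => /(compS _ _ XS) ZS /(compS _ _ XS) Z'S fZ.
    by rewrite -[Z]imageK // fZ imageK.
  exists (f @` Z); last by apply/imageK/(compS _ _ (image_subS XS) fXZ).
  by rewrite -[X]imageK //; apply: image_irr_components => //; exact: image_subS.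
move=> F _ [Z0 FZ0] Fcomp; have FS Z : F Z -> Z `<=` S.
  by move=> /Fcomp /(compS _ _ XS).
split; last by apply: image_zdim => M FM; apply: (FS _ FZ0); exact: FM.
apply/seteqP; split=> [_ [M FM <-] Z FZ|M fFM]; first by exists M; [exact: FM|].
have [M0 Z0M0 M0E] := fFM Z0 FZ0; have SM0 := FS _ FZ0 _ Z0M0.
exists M0 => // Z FZ; have [M1 ZM1 M1E] := fFM Z FZ.
by rewrite -[M0]fK // M0E -M1E fK //; exact: (FS Z).
Qed.

Lemma involution_biregular X Y : X `<=` S -> f @` X = Y -> biregular X Y f.
Proof.
move=> XS <-; have fXS := image_subS XS; split.
  by apply: polynomial_on_regular fP XS _ => M XM; exists M.
exists f; split=> [|M /XS /fK//|M /fXS /fK//].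
apply: polynomial_on_regular fP fXS _ => _ [M XM <-].
by rewrite fK //; exact: XS.
Qed.

End Transport.

Section Polynomiality.
Variables (R : realType) (n : nat).
Local Notation C := (complex R).
Local Open Scope ring_scope.
Local Open Scope classical_set_scope.

Definition generic_mx : 'M[mpoly (n * n) C]_n :=
  \matrix_(i, j) mpolyX C (mnm1 (mxvec_index i j)).

Lemma eval_generic_mx (M : 'M[C]_n) i j : mx_eval (generic_mx i j) M = M i j.
Proof. by rewrite mxE /mx_eval mevalXU mxvecE. Qed.

Lemma tau_polynomial : polynomial_on (@SL R n) (@tau_map R n).
Proof.
by exists generic_mx^T => M _ i j; rewrite /tau_map mxE [_^T _ _]mxE eval_generic_mx.
Qed.

Lemma alpha_polynomial : polynomial_on (@SL R n) (@alpha_map R n).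
Proof.
exists (\matrix_(i, j) generic_mx (rev_ord j) (rev_ord i)) => M _ i j.
by rewrite alphaE mxE eval_generic_mx.
Qed.

Lemma iota_polynomial : polynomial_on (@SL R n) (@iota_map R n).
Proof.
exists (\adj generic_mx) => M MS i j.
rewrite /iota_map /invmx (SL_unit MS) MS invr1 scale1r.
have evalM : map_mx (meval (mxvec M 0)) generic_mx = M.
  by apply/matrixP=> a b; rewrite mxE -[RHS]eval_generic_mx.
by rewrite -{1}evalM -map_mx_adj mxE.
Qed.

End Polynomiality.

Local Open Scope ring_scope.
Local Open Scope classical_set_scope.

Theorem theorem1p5 (R : realType) (n : nat) (hn : (2 <= n)%N) :
  let w0 := longest n in
  let D := @deep_locus R n in
  [/\ forall u v : 'S_n,
      [/\ (@tau_map R n) @` D u v = D (v^-1)%g (u^-1)%g /\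
          biregular (D u v) (D (v^-1)%g (u^-1)%g) (@tau_map R n),
          (@alpha_map R n) @` D u v
            = D (w0 * u^-1 * w0)%g (w0 * v^-1 * w0)%g /\
          biregular (D u v) (D (w0 * u^-1 * w0)%g (w0 * v^-1 * w0)%g)
            (@alpha_map R n)
        & (@iota_map R n) @` D u v = D (u^-1)%g (v^-1)%g /\
          biregular (D u v) (D (u^-1)%g (v^-1)%g) (@iota_map R n)],
      [/\ (@tau_map R n) @` D w0 w0 = D w0 w0,
          (@alpha_map R n) @` D w0 w0 = D w0 w0
        & (@iota_map R n) @` D w0 w0 = D w0 w0]
    & forall u v : 'S_n,
      [/\ preserves_components (D u v) (@tau_map R n),
          preserves_components (D u v) (@alpha_map R n)
        & preserves_components (D u v) (@iota_map R n)]].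
Proof.
move=> w0 D; have w0E : w0 = rev_perm n by exact: longestE.
have w0V : (w0^-1 = w0)%g by rewrite w0E; apply/mulg1_eq/rev_permK.
have w0J : (w0 * w0^-1 * w0 = w0)%g by rewrite mulgV mul1g.
have tauA := tau_antisymmetry R n.
have iotaA := iota_antisymmetry R n.
have alphaA := alpha_antisymmetry R n.
have tauD u v : (@tau_map R n) @` D u v = D (v^-1)%g (u^-1)%g.
  exact: anti_deep_locus_image tauA u v.
have alphaD u v : (@alpha_map R n) @` D u v
    = D (w0 * u^-1 * w0)%g (w0 * v^-1 * w0)%g.
  by rewrite w0E; exact: anti_deep_locus_image alphaA u v.
have iotaD u v : (@iota_map R n) @` D u v = D (u^-1)%g (v^-1)%g.
  exact: anti_deep_locus_image iotaA u v.
have DS u v : D u v `<=` @SL R n by move=> M; exact: deep_locus_SL.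
have biregular_of swap sigma g f (fA : antisymmetry swap sigma g f)
    (fP : polynomial_on (@SL R n) f) u v Y : f @` D u v = Y -> biregular (D u v) Y f.
  by move=> <-; apply: (involution_biregular fP (anti_SL fA) (antiK fA)).
have components_of swap sigma g f (fA : antisymmetry swap sigma g f)
    (fP : polynomial_on (@SL R n) f) u v : preserves_components (D u v) f.
  exact: (involution_preserves_components fP (anti_SL fA) (antiK fA)).
split.
- move=> u v; split; split=> //.
  + exact: (biregular_of _ _ _ _ tauA (tau_polynomial R n)).
  + exact: (biregular_of _ _ _ _ alphaA (alpha_polynomial R n)).
  + exact: (biregular_of _ _ _ _ iotaA (iota_polynomial R n)).
- by split; rewrite ?tauD ?alphaD ?iotaD ?w0J ?w0V.
- move=> u v; split.
  + exact: (components_of _ _ _ _ tauA (tau_polynomial R n)).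
  + exact: (components_of _ _ _ _ alphaA (alpha_polynomial R n)).
  + exact: (components_of _ _ _ _ iotaA (iota_polynomial R n)).
Qed.
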